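(* The deterministic query complexity of the HiddenPermutation problem with $n$ positions is $\Theta(n\log n)$. That is, if $D(n)$ denotes the minimum, over all deterministic strategies, of the worst-case number (over all secrets $(z,\pi)\in\{0,1\}^n\times S_n$) of queries required to identify the secret, then $D(n)=\Theta(n\log n)$ as $n\to\infty$.
   Context: $[n]=\{1,\dots,n\}$, $[0..n]=\{0,1,\dots,n\}$, and $S_n$ is the set of permutations of $[n]$. For $z\in\{0,1\}^n$ and $\pi\in S_n$ define $f_{z,\pi}:\{0,1\}^n\to[0..n]$ by $f_{z,\pi}(x)=\max\{i\in[0..n]\mid \forall j\le i:\ z_{\pi(j)}=x_{\pi(j)}\}$. HiddenPermutation problem: a secret pair $(z,\pi)\in\{0,1\}^n\times S_n$ is to be identified by adaptively asking queries $x^1,x^2,\ldots\in\{0,1\}^n$; the answer to query $x^i$ is the score $s^i=f_{z,\pi}(x^i)$. One may stop after $t$ queries if there is only a single pair $(z',\pi')\in\{0,1\}^n\times S_n$ with $f_{z',\pi'}(x^i)=s^i$ for all $1\le i\le t$; the secret is then identified. A deterministic strategy is a rooted tree of outdegree $n+1$ in which a query in $\{0,1\}^n$ is associated with every (internal) node. The search starts at the root; at a node, the associated query is asked and the search proceeds to the child selected by the score. The complexity of a strategy on input $(z,\pi)$ is the number of queries required to identify the secret; the complexity of a deterministic strategy is its worst-case complexity over all inputs. The deterministic query complexity is the minimum complexity of a deterministic strategy. *)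

(* Defs.v *)
From mathcomp Require Import all_boot all_order all_algebra.
From mathcomp Require Import fingroup perm.
From mathcomp Require Import all_classical all_reals all_analysis.

Set Implicit Arguments.
Unset Strict Implicit.
Unset Printing Implicit Defensive.

Definition query (n : nat) := {ffun 'I_n -> bool}.

Definition secret (n : nat) := (query n * 'S_n)%type.

(* Positions are numbered 0, ..., n - 1, so "for all j in {1, ..., i}" becomes
   "for all j < i"; scores remain in {0, ..., n}. *)
Definition agree n (s : secret n) (x : query n) (i : nat) : bool :=
  [forall j : 'I_n, (j < i) ==> (s.1 (s.2 j) == x (s.2 j))].

Definition score n (s : secret n) (x : query n) : 'I_n.+1 :=
  [arg max_(i > ord0 :> 'I_n.+1 | agree s x i) (i : nat)].

(* Only finite trees: a strategy with finite worst-case complexity never needs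
   to be continued below the depth given by that complexity. *)
Inductive strategy (n : nat) : Type :=
| Stop
| Ask (x : query n) (next : 'I_n.+1 -> strategy n).

Arguments Stop {n}.
Arguments Ask {n} x next.

Fixpoint transcript n (T : strategy n) (s : secret n) :
    seq (query n * 'I_n.+1) :=
  match T with
  | Stop => [::]
  | Ask x next => (x, score s x) :: transcript (next (score s x)) s
  end.

Definition consistent n (h : seq (query n * 'I_n.+1)) (s : secret n) : bool :=
  all (fun qa => score s qa.1 == qa.2) h.

Definition identified n (h : seq (query n * 'I_n.+1)) : bool :=
  #|[set s | consistent h s]| == 1.

Definition solves n (T : strategy n) : Prop :=
  forall s : secret n, identified (transcript T s).

(* The least t such that the first t queries and answers identify the secret.
   The value is meaningful only if the whole transcript identifies it. *)
Definition complexity_on n (T : strategy n) (s : secret n) : nat :=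
  find (fun t => identified (take t (transcript T s)))
       (iota 0 (size (transcript T s)).+1).

Definition complexity n (T : strategy n) : nat :=
  \max_(s : secret n) complexity_on T s.

Lemma leq_score n (s : secret n) (x : query n) (i : 'I_n.+1) :
  (i <= score s x) = agree s x i.
Proof.
rewrite /score; case: arg_maxnP => [|k kP kmax]; first exact/forallP.
apply/idP/idP => [ik|/kmax//].
apply/forallP => j; apply/implyP => ji.
by move/forallP/(_ j)/implyP: kP; apply; apply: leq_trans ik.
Qed.

Lemma score_eq_max n (s : secret n) (x : query n) :
  (score s x == ord_max) = (s.1 == x).
Proof.
rewrite -val_eqE /= eqn_leq -ltnS ltn_ord /= (leq_score s x ord_max).
apply/forallP/eqP => [H|<- j]; last by rewrite eqxx implybT.
apply/ffunP => j; move: (H (s.2^-1 j)%g).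
by rewrite permKV ltn_ord => /eqP.
Qed.

Lemma score_inj n (s s' : secret n) : score s =1 score s' -> s = s'.
Proof.
case: s s' => [z p] [z' p'] E.
have zz' : z' = z.
  by apply/eqP; move: (score_eq_max (z', p') z); rewrite -E score_eq_max eqxx.
subst z'; congr pair.
pose flip (k : 'I_n) : query n := [ffun i => z i (+) (i == k)].
have agr (q : 'S_n) (k : 'I_n) m : agree (z, q) (flip k) m = (m <= (q^-1 k)%g).
  apply/forallP/idP => [/(_ (q^-1 k)%g)|mk j].
    by rewrite /= permKV ffunE eqxx ltnNge; case: (m <= _)%N; case: (z k).
  apply/implyP => jm; rewrite /= ffunE.
  have /negbTE -> : q j != k.
    apply/eqP => qjk; move: (leq_trans jm mk).
    by rewrite -qjk permK ltnn.
  by rewrite addbF.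
have Q k : (p^-1 k)%g = (p'^-1 k)%g.
  have key (q : 'S_n) : (score (z, q) (flip k) : nat) = (q^-1 k)%g.
    apply/eqP; rewrite eqn_leq.
    have wd : (q^-1 k)%g < n.+1 by apply: ltnW; rewrite ltnS ltn_ord.
    rewrite -(agr q k) -leq_score leqnn /=.
    by rewrite (leq_score _ _ (Ordinal wd)) agr.
  by apply/val_inj; rewrite /= -!key E.
by apply: invg_inj; apply/permP.
Qed.

Lemma exists_solving_strategy n : exists T : strategy n, solves T.
Proof.
pose T := foldr (fun x U => Ask x (fun=> U)) Stop (enum {: query n}).
have trE s : transcript T s = [seq (x, score s x) | x <- enum {: query n}].
  by rewrite /T; elim: (enum _) => //= x l ->.
exists T => s; rewrite /identified trE; apply/cards1P; exists s.
apply/setP => s'; rewrite !inE; apply/allP/eqP => [H|-> _ /mapP[x _ ->] //=].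
apply: score_inj => x; apply/eqP.
by apply: (H (x, score s x)); rewrite map_f// mem_enum.
Qed.

Lemma exists_complexity n :
  exists t, `[< exists2 T : strategy n, solves T & complexity T = t >].
Proof.
have [T TP] := exists_solving_strategy n.
by exists (complexity T); apply/asboolP; exists T.
Qed.

Definition query_complexity (n : nat) : nat := ex_minn (exists_complexity n).

(* Main.v *)
Require Import Defs.
From mathcomp Require Import all_boot all_order all_algebra.
From mathcomp Require Import fingroup perm.
From mathcomp Require Import all_classical all_reals all_analysis.
From mathcomp Require Import zify lra.

(* Upper bound: once pi(1..k-1) and the corresponding bits of z are known, one
   query that is right on these positions yields a reference query that is wrong
   on pi(k), and flipping that reference on half of the candidates tells which
   half contains pi(k); so every pi(k) costs about log n queries.

   Lower bound: an adversary fixes pi two entries at a time. With pi(1..k-1)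
   already fixed, it maintains sets A, a subset of B, of candidates for pi(k) and
   pi(k+1), together with a reference w on which z agrees at pi(k) and disagrees
   at pi(k+1). If a query differs from w on a set D containing half of A, the
   answer is k-1 and A is intersected with D; otherwise the answer is k and D is
   removed from both A and B. So A is at most halved, and each of Omega(n) pairs
   costs Omega(log n) queries. *)

Set Implicit Arguments.
Unset Strict Implicit.
Unset Printing Implicit Defensive.

(** * Query games on sets of secrets *)

(** The game without its trees: [S] holds the secrets still possible and [a] is the adversary's
    reply to [x]. Both bounds become inductions on the number [m] of remaining queries. *)
Fixpoint resists n (m : nat) (S : {set secret n}) : Prop :=
  if m is m'.+1 then
    forall x, exists a, resists m' (S :&: [set s | score s x == a])
  else 1 < #|S|.

Fixpoint solvable n (m : nat) (S : {set secret n}) : Prop :=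
  if m is m'.+1 then
    exists x, forall a, solvable m' (S :&: [set s | score s x == a])
  else #|S| <= 1.

Lemma resistsS n m (S S' : {set secret n}) :
  S \subset S' -> resists m S -> resists m S'.
Proof.
elim: m S S' => [|m IH] S S' sub /=; 
  first by move/leq_trans; apply; apply: subset_leq_card.
move=> H x; have [a Ha] := H x; exists a.
by apply: IH Ha; apply: finset.setSI.
Qed.

Lemma solvableS n m (S S' : {set secret n}) :
  S \subset S' -> solvable m S' -> solvable m S.
Proof.
elim: m S S' => [|m IH] S S' sub /=; first exact/leq_trans/subset_leq_card.
move=> [x H]; exists x => a.
by apply: IH (H a); apply: finset.setSI.
Qed.

Lemma resists_card n m (S : {set secret n}) : resists m S -> 1 < #|S|.
Proof.
elim: m S => [//|m IH] S /(_ [ffun=> false]) [a /IH /leq_trans]; apply.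
exact/subset_leq_card/finset.subsetIl.
Qed.

(** Descend in [T] along the adversary's replies: the secrets left at the end have all received the
    same replies. If [T] stops early, any two remaining secrets collide. *)
Lemma resists_collision n m (S : {set secret n}) (T : strategy n) :
  resists m S ->
  exists s s', [/\ s \in S, s' \in S, s != s' &
    take m (transcript T s) = take m (transcript T s')].
Proof.
elim: T m S => [|x next IH] m S res.
  by have /card_gt1P[s [s' [Ss Ss' ss']]] := resists_card res; exists s, s'.
case: m res => [|m] /= res.
  have /card_gt1P[s [s' [Ss Ss' ss']]] := res; exists s, s'; split=> //.
have [a /(IH a)[s [s' []]]] := res x.
rewrite !inE => /andP[Ss /eqP sa] /andP[Ss' /eqP s'a] ss' E.
by exists s, s'; split=> //; rewrite sa s'a E.
Qed.

Lemma consistent_transcript n (T : strategy n) s : consistent (transcript T s) s.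
Proof. by elim: T => //= x next IH; rewrite eqxx /=; apply: IH. Qed.

Lemma consistent_take n t (h : seq (query n * 'I_n.+1)) s :
  consistent h s -> consistent (take t h) s.
Proof. by move=> /allP H; apply/allP => q /mem_take/H. Qed.

Lemma identifiedP n (h : seq (query n * 'I_n.+1)) s s' :
  identified h -> consistent h s -> consistent h s' -> s = s'.
Proof.
move=> /cards1P[s0 E] hs hs'.
have: s \in [set s0] by rewrite -E inE.
have: s' \in [set s0] by rewrite -E inE.
by rewrite !inE => /eqP-> /eqP->.
Qed.

Lemma complexity_onP n (T : strategy n) s : solves T ->
  identified (take (complexity_on T s) (transcript T s)) /\
  complexity_on T s <= size (transcript T s).
Proof.
move=> sol; set p := fun t => identified (take t (transcript T s)).
have hs : has p (iota 0 (size (transcript T s)).+1).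
  apply/hasP; exists (size (transcript T s)); first by rewrite mem_iota /= add0n.
  by rewrite /p take_size.
have := hs; rewrite has_find size_iota ltnS => lt; split=> //.
by have := nth_find 0 hs; rewrite nth_iota ?add0n.
Qed.

Lemma resists_query_complexity n m :
  resists m [set: secret n] -> m < query_complexity n.
Proof.
move=> res; rewrite /query_complexity; case: ex_minnP => t /asboolP[T sol <-] _.
rewrite ltnNge; apply/negP => le.
have [s [s' [_ _ /eqP ss' E]]] := resists_collision T res; apply: ss'.
have [idt _] := complexity_onP s sol.
have cm : complexity_on T s <= m.
  by apply: leq_trans le; rewrite /complexity (leq_bigmax s).
apply: (identifiedP idt); first exact/consistent_take/consistent_transcript.
rewrite -(take_takel _ cm) E.
exact/consistent_take/consistent_take/consistent_transcript.
Qed.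

Lemma solvable_strategy n m (S : {set secret n}) : solvable m S ->
  exists T : strategy n, forall s, s \in S ->
    size (transcript T s) <= m /\
    forall s', s' \in S -> consistent (transcript T s) s' -> s' = s.
Proof.
elim: m S => [|m IH] S /=.
  by move=> /card_le1_eqP S1; exists Stop => s Ss; split=> // s' Ss' _; exact: S1.
move=> [x H].
(* Choice glues the strategies obtained for the single scores into one continuation. *)
have [next nextP] := choice (fun a => IH _ (H a)).
exists (Ask x next) => s Ss /=.
have [|le uni] := nextP (score s x) s; first by rewrite !inE Ss /=.
split=> // s' Ss' /andP[sx cs']; apply: uni => //.
by rewrite !inE Ss'.
Qed.

Lemma solvable_query_complexity n m :
  solvable m [set: secret n] -> query_complexity n <= m.
Proof.
move=> /solvable_strategy[T HT].
have sol : solves T.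
  move=> s; apply/cards1P; exists s; apply/setP => s'; rewrite !inE.
  apply/idP/eqP => [cs'|->]; last exact: consistent_transcript.
  by apply: (HT s (finset.in_setT _)).2 => //; rewrite finset.in_setT.
rewrite /query_complexity; case: ex_minnP => t _ /(_ (complexity T)) min.
apply: leq_trans (min _) _; first by apply/asboolP; exists T.
apply/bigmax_leqP => s _.
have [_ le] := complexity_onP s sol.
exact: leq_trans le (HT s (finset.in_setT _)).1.
Qed.

(** * Secrets sharing a known prefix *)

(** The state of knowledge between two phases of either bound; [z] is fixed only at the positions
    reached by the first [k] entries of the permutation. *)
Definition same_prefix n k (s : secret n) : {set secret n} :=
  [set s' : secret n | [forall j : 'I_n, (j < k) ==>
     (s'.2 j == s.2 j) && (s'.1 (s.2 j) == s.1 (s.2 j))]].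

Lemma same_prefixP n k (s s' : secret n) :
  reflect (forall j : 'I_n, j < k ->
             s'.2 j = s.2 j /\ s'.1 (s.2 j) = s.1 (s.2 j))
          (s' \in same_prefix k s).
Proof.
rewrite inE; apply: (iffP forallP) => H j.
  by move=> jk; move: (H j); rewrite jk => /andP[/eqP-> /eqP->].
by apply/implyP => /H[-> ->]; rewrite !eqxx.
Qed.

Lemma same_prefix0 n (s : secret n) : same_prefix 0 s = [set: secret n].
Proof. by apply/setP => s'; rewrite [RHS]inE; apply/same_prefixP. Qed.

Lemma agree_same_prefix n k (s s' : secret n) x i : s' \in same_prefix k s ->
  i <= k -> agree s' x i = agree s x i.
Proof.
move=> /same_prefixP P ik; apply: eq_forallb => j.
by case: ltnP => //= ji; have [-> ->] := P j (leq_trans ji ik).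
Qed.

Lemma agreeS n (s : secret n) x (i : 'I_n) :
  agree s x i.+1 = agree s x i && (s.1 (s.2 i) == x (s.2 i)).
Proof.
apply/forallP/andP => [H|[/forallP H e] j].
  split; last by have := H i; rewrite ltnSn.
  by apply/forallP => j; apply/implyP => ji; have := H j; rewrite ltnS ltnW.
rewrite ltnS leq_eqVlt; case: eqVneq => [/val_inj->|_] //=; exact: H.
Qed.

Lemma score_eqS n (s : secret n) x k : k <= n ->
  agree s x k -> ~~ agree s x k.+1 -> score s x = k :> nat.
Proof.
move=> kn ag nag; apply/eqP; rewrite eqn_leq.
have kn1 : k < n.+1 by [].
rewrite (leq_score s x (Ordinal kn1)) /= ag andbT leqNgt.
apply: contra nag => kS.
have lt : k.+1 < n.+1 := leq_ltn_trans kS (ltn_ord _).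
by rewrite -(leq_score s x (Ordinal lt)).
Qed.

(** A query that errs within the shared prefix has its score settled there, so it separates no two
    secrets of [same_prefix k s]. *)
Lemma same_prefix_score n k (s s' : secret n) x : s' \in same_prefix k s ->
  ~~ agree s x k -> score s' x = score s x.
Proof.
move=> P nag; apply/eqP; rewrite -val_eqE /= eqn_leq.
have small (t : secret n) : t \in same_prefix k s -> score t x <= k.
  move=> Pt; rewrite leqNgt; apply: contra nag => kS.
  rewrite -(agree_same_prefix _ Pt (leqnn _)).
  have lt : k < n.+1 := leq_ltn_trans (ltnW kS) (ltn_ord _).
  by rewrite -(leq_score t x (Ordinal lt)) ltnW.
have Ps : s \in same_prefix k s by apply/same_prefixP.
rewrite (leq_score s x) -(agree_same_prefix _ P) ?small// -leq_score leqnn /=.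
by rewrite (leq_score s' x) (agree_same_prefix _ P) ?small// -leq_score leqnn.
Qed.

(** These are the positions still available to the entries from [k] on. *)
Definition rest n k (s : secret n) : {set 'I_n} := [set p | k <= (s.2^-1 p)%g].

Lemma card_rest n k (s : secret n) : #|rest k s| = n - k.
Proof.
have -> : rest k s = s.2 @: [set j : 'I_n | k <= j].
  apply/setP => p; rewrite inE; apply/idP/imsetP => [kp|[j + ->]].
    by exists (s.2^-1 p)%g; rewrite ?inE ?permKV.
  by rewrite inE permK.
rewrite card_imset; last exact: perm_inj.
rewrite -sum1_card (eq_bigl (fun j : 'I_n => k <= j)); last first.
  by move=> j; rewrite inE.
by rewrite -(big_geq_mkord k n xpredT (fun=> 1)) sum_nat_const_nat muln1.
Qed.

Lemma rest_same_prefix n k (s s' : secret n) (j : 'I_n) :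
  s' \in same_prefix k s -> k <= j -> s'.2 j \in rest k s.
Proof.
move=> /same_prefixP P kj; rewrite inE leqNgt; apply/negP => lt.
have [+ _] := P _ lt; rewrite permKV => /perm_inj E.
by move: lt; rewrite E ltnNge kj.
Qed.

(** * Upper bound by binary search *)

(* What is known during the binary search for [s'.2 k]: it lies in [V], and a
   query right on the first [k] positions and equal to [w] elsewhere scores [k]. *)
Definition candidates n (k : 'I_n) s (w : query n) (V : {set 'I_n}) :
    {set secret n} :=
  [set s' : secret n in same_prefix k s |
    (s'.2 k \in V) && (s'.1 (s'.2 k) != w (s'.2 k))].

(** The bit at [p] needs no query of its own: it is the negation of [w p]. *)
Lemma candidates1 n (k : 'I_n) (s s0 : secret n) w p :
  s0 \in candidates k s w [set p] ->
  candidates k s w [set p] \subset same_prefix k.+1 s0.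
Proof.
rewrite !inE => /andP[P0 /andP[/eqP e0 n0]].
have {}P0 : s0 \in same_prefix k s by rewrite inE.
apply/fintype.subsetP => s'; rewrite !inE => /andP[P' /andP[/eqP e' n']].
have {}P' : s' \in same_prefix k s by rewrite inE.
apply/forallP => j; apply/implyP; rewrite ltnS leq_eqVlt.
case: eqVneq => [/val_inj-> _|_ /= jk].
  rewrite e' e0 eqxx /=; move: n0 n'; rewrite e' e0.
  by case: (s0.1 p) (s'.1 p) (w p) => [] [] [].
move/same_prefixP: P0 => /(_ _ jk)[-> ->].
by move/same_prefixP: P' => /(_ _ jk)[-> ->]; rewrite !eqxx.
Qed.

Lemma same_prefix_last n (s : secret n) : same_prefix n s = [set s].
Proof.
apply/setP => s'; rewrite [RHS]inE; apply/same_prefixP/eqP => [H|-> //].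
case: s s' H => [z p] [z' p'] /= H.
have -> : p' = p by apply/permP => j; have [] := H j (ltn_ord j).
congr pair; apply/ffunP => j.
by have [_] := H (p^-1 j)%g (ltn_ord _); rewrite permKV.
Qed.

Lemma solvable0 n m : solvable m (finset.set0 : {set secret n}).
Proof.
elim: m => [|m IH] /=; first by rewrite cards0.
by exists [ffun=> false] => a; rewrite finset.set0I.
Qed.

(** Correcting [x] on the known prefix forces a score of at least [k], so whether the score exceeds
    [k] tests a single bit, the one at entry [k]. *)
Definition graft n k (s : secret n) (x : query n) : query n :=
  [ffun p => if p \in rest k s then x p else s.1 p].

Lemma agree_graft n k (s s' : secret n) x :
  s' \in same_prefix k s -> agree s' (graft k s x) k.
Proof.
move=> P; rewrite (agree_same_prefix _ P)//; apply/forallP => j.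
by apply/implyP => jk; rewrite ffunE inE permK leqNgt jk.
Qed.

Lemma agree_graftS n (k : 'I_n) (s s' : secret n) x :
  s' \in same_prefix k s ->
  agree s' (graft k s x) k.+1 = (s'.1 (s'.2 k) == x (s'.2 k)).
Proof.
move=> P; rewrite agreeS agree_graft//= ffunE.
by rewrite (rest_same_prefix P (leqnn _)).
Qed.

Lemma graft_score n (k : 'I_n) (s s' : secret n) x :
  s' \in same_prefix k s ->
  (k < score s' (graft k s x)) = (s'.1 (s'.2 k) == x (s'.2 k)).
Proof.
move=> P; rewrite -(agree_graftS _ P).
have lt : k.+1 < n.+1 by rewrite ltnS.
by rewrite (leq_score s' _ (Ordinal lt)).
Qed.

Lemma split_card (T : finType) (V : {set T}) e : #|V| <= 2 ^ e.+1 ->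
  exists A : {set T}, [/\ A \subset V, #|A| <= 2 ^ e & #|V :\: A| <= 2 ^ e].
Proof.
move=> le; pose A := [set x in take (2 ^ e) (enum V)].
have cA : #|A| = minn (2 ^ e) #|V|.
  rewrite cardsE (card_uniqP (take_uniq _ (enum_uniq _))) size_take_min.
  by rewrite -cardE.
have AV : A \subset V.
  by apply/fintype.subsetP => x; rewrite inE => /mem_take; rewrite mem_enum.
exists A; split=> //; first by rewrite cA geq_minl.
rewrite cardsDS// cA; rewrite expnS in le; lia.
Qed.

Lemma solvable_candidates n (k : 'I_n) m s w e (V : {set 'I_n}) :
  (forall s' : secret n, solvable m (same_prefix k.+1 s')) ->
  #|V| <= 2 ^ e -> solvable (e + m) (candidates k s w V).
Proof.
move=> H; elim: e V => [|e IH] V leV.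
  have [E|[s0 s0P]] := set_0Vmem (candidates k s w V).
    by rewrite E; apply: solvable0.
  have /cards1P[p Ep] : #|V| == 1.
    rewrite eqn_leq leV card_gt0; apply/set0Pn; exists (s0.2 k).
    by move: s0P; rewrite inE => /andP[_ /andP[]].
  rewrite Ep in s0P *; exact: (solvableS (candidates1 s0P) (H s0)).
have [A [AV leA leVA]] := split_card leV.
(* Since [z] differs from [w] at [s'.2 k], flipping [w] exactly on [A] makes the score exceed [k] if
   and only if [s'.2 k] lies in [A]. *)
exists (graft k s [ffun p => w p (+) (p \in A)]) => a.
have [ka|ak] := ltnP k a.
  apply: (solvableS _ (IH A leA)); apply/fintype.subsetP => s'.
  rewrite !inE -andbA => /and3P[P /andP[sV nw] /eqP sa]; rewrite P nw andbT /=.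
  move: ka; rewrite -sa graft_score ?inE// ffunE.
  by move: nw; case: (_ \in A); case: (s'.1 _) (w _) => [] [].
apply: (solvableS _ (IH _ leVA)); apply/fintype.subsetP => s'.
rewrite !inE -andbA => /and3P[P /andP[sV nw] /eqP sa]; rewrite P nw sV !andbT /=.
move: ak; rewrite -sa leqNgt graft_score ?inE// ffunE.
by move: nw; case: (_ \in A); case: (s'.1 _) (w _) => [] [].
Qed.

Lemma solvable_same_prefix n (k : 'I_n) m (s : secret n) :
  (forall s' : secret n, solvable m (same_prefix k.+1 s')) ->
  solvable (up_log 2 n + m).+1 (same_prefix k s).
Proof.
(* The all-false query reveals the bit of [z] at entry [k]; the constant reference [k < a] is its
   negation, hence wrong there. *)
move=> H; exists (graft k s [ffun=> false]) => a.
have len : #|[set: 'I_n]| <= 2 ^ up_log 2 n by rewrite cardsT card_ord up_logP.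
apply: (solvableS (S' := candidates k s [ffun=> k < a] [set: 'I_n]));
  last exact: solvable_candidates.
apply/fintype.subsetP => s'; rewrite !inE => /andP[P /eqP <-]; rewrite P /=.
by rewrite !ffunE graft_score ?inE// ffunE; case: (s'.1 _).
Qed.

(** Induction on the number [k] of unknown entries: each costs one query for the reference and
    [up_log 2 n] for the search. *)
Lemma solvable_all n k (s : secret n) : k <= n ->
  solvable (k * (up_log 2 n).+1) (same_prefix (n - k) s).
Proof.
elim: k s => [|k IH] s kn; first by rewrite subn0 same_prefix_last /= cards1.
have lt : n - k.+1 < n by rewrite ltn_subrL; apply: leq_trans kn.
rewrite mulSn addSn -[n - k.+1]/(nat_of_ord (Ordinal lt)).
by apply: solvable_same_prefix => s'; rewrite /= subnSK//; apply/IH/ltnW.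
Qed.

Lemma query_complexity_leq n : query_complexity n <= n * (up_log 2 n).+1.
Proof.
apply: solvable_query_complexity.
have := solvable_all ([ffun=> false], 1%g) (leqnn n).
by rewrite subnn same_prefix0.
Qed.

(** * Lower bound by an adversary *)

Definition pairs n (k k1 : 'I_n) s (w : query n) (A B : {set 'I_n}) :
    {set secret n} :=
  [set s' : secret n in same_prefix k s |
    [&& s'.2 k \in A, s'.2 k1 \in B, s'.1 (s'.2 k) == w (s'.2 k)
      & s'.1 (s'.2 k1) != w (s'.2 k1)]].

Lemma pairsP n (k k1 : 'I_n) s (w : query n) (A B : {set 'I_n}) (s' : secret n) :
  reflect (s' \in same_prefix k s /\
    [/\ s'.2 k \in A, s'.2 k1 \in B, s'.1 (s'.2 k) = w (s'.2 k)
      & s'.1 (s'.2 k1) != w (s'.2 k1)]) (s' \in pairs k k1 s w A B).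
Proof.
rewrite [s' \in pairs _ _ _ _ _ _]inE; apply: (iffP andP) => -[P].
  by move=> /and4P[? ? /eqP ? ?].
by case=> -> -> -> ->; rewrite eqxx.
Qed.

Lemma pairsS n (k k1 : 'I_n) s w (A A' B B' : {set 'I_n}) :
  A \subset A' -> B \subset B' -> pairs k k1 s w A B \subset pairs k k1 s w A' B'.
Proof.
move=> /fintype.subsetP sA /fintype.subsetP sB.
apply/fintype.subsetP => s' /pairsP[P [kA k1B e0 e1]].
by apply/pairsP; split=> //; split=> //; [exact: sA | exact: sB].
Qed.

(** The end of a phase: the adversary commits to [a] and [a'] as the next two entries, with the bits
    that [w] prescribes. *)
Lemma same_prefix_sub_pairs n (k k1 : 'I_n) s w a a' (A B : {set 'I_n}) :
  k1 = k.+1 :> nat -> a \in A -> a' \in B -> a \in rest k s -> a' \in rest k s ->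
  a != a' ->
  exists s0, same_prefix k.+2 s0 \subset pairs k k1 s w A B.
Proof.
move=> k1E aA a'B ar a'r aa'.
have kk1 : k1 != k by rewrite -val_eqE /= k1E gtn_eqF.
(* Right multiplication by a transposition swaps values. The swapped values occur only at entries
   from [k] on, so the prefix survives. *)
pose q1 := (s.2 * tperm (s.2 k) a)%g.
pose q := (q1 * tperm (q1 k1) a')%g.
have nr (j : 'I_n) : j < k -> s.2 j \notin rest k s.
  by move=> jk; rewrite inE permK -ltnNge.
have neq (j : 'I_n) b : j < k -> b \in rest k s -> b != s.2 j.
  by move=> jk br; apply: contraNneq (nr j jk) => <-.
have q1k : q1 k = a by rewrite permM tpermL.
have q1j (j : 'I_n) : j < k -> q1 j = s.2 j.
  move=> jk; rewrite permM tpermD//; last exact: neq.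
  by rewrite (inj_eq perm_inj) -val_eqE /= gtn_eqF.
have qk1 : q k1 = a' by rewrite permM tpermL.
have qk : q k = a.
  have q1k1 : q1 k1 != a.
    by rewrite -[X in _ != X]q1k (inj_eq (@perm_inj _ q1)).
  by rewrite permM q1k tpermD// eq_sym.
have qj (j : 'I_n) : j < k -> q j = s.2 j.
  move=> jk; rewrite permM (q1j j)// tpermD//; last exact: neq.
  rewrite -[X in _ != X]q1j// (inj_eq (@perm_inj _ q1)) -val_eqE /= k1E gtn_eqF//.
  by rewrite ltnS ltnW.
pose z : query n := [ffun p => if p == a then w a else
                               if p == a' then ~~ w a' else s.1 p].
exists (z, q); apply/fintype.subsetP => s' /same_prefixP P; apply/pairsP; split.
  apply/same_prefixP => j jk.
  have [] := P j (leq_trans jk (leq_trans (leqnSn _) (leqnSn _))).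
  rewrite /= qj// => -> ->; split=> //.
  by rewrite ffunE !(eq_sym (s.2 j)) !(negbTE (neq _ _ jk _)).
have [] := P k; first by rewrite ltnS leqnSn.
have [] := P k1; first by rewrite k1E.
rewrite /= qk qk1 => -> z1 -> z0; rewrite z0 z1 !ffunE !eqxx.
by rewrite (eq_sym a') (negbTE aa'); split=> //; case: (w a').
Qed.

(* [A \subset B] is what prevents a score above [k.+1]: when most of [A] avoids
   the set [D], so does enough of [B] to answer [k.+1] again. *)
Lemma resists_pairs n (k k1 : 'I_n) m s w e (A B : {set 'I_n}) :
  k1 = k.+1 :> nat ->
  (forall s' : secret n, resists m (same_prefix k.+2 s')) ->
  A \subset B -> B \subset rest k s -> 2 ^ e.+1 <= #|A| ->
  resists (e + m) (pairs k k1 s w A B).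
Proof.
move=> k1E H; elim: e A B => [|e IH] A B AB Br leA.
  have /card_gt1P[a [a' [aA a'A aa']]] := leA.
  have sAB := fintype.subsetP AB; have sBr := fintype.subsetP Br.
  have [s0 s0P] := same_prefix_sub_pairs w k1E aA (sAB _ a'A)
     (sBr _ (sAB _ aA)) (sBr _ (sAB _ a'A)) aa'.
  exact: resistsS s0P (H s0).
move=> x; have [ag|nag] := boolP (agree s x k); last first.
  (* The query errs in the prefix: the reply is forced and nothing is learnt. *)
  exists (score s x); apply: (resistsS (S := pairs k k1 s w A B)).
    apply/fintype.subsetP => s' s'P; rewrite finset.in_setI s'P inE.
    have [P _] := pairsP _ _ _ _ _ _ _ s'P.
    by rewrite (same_prefix_score P nag) eqxx.
  by apply: IH => //; apply: leq_trans leA; rewrite leq_exp2l.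
have agk s' : s' \in same_prefix k s -> agree s' x k.
  by move=> P; rewrite (agree_same_prefix _ P).
pose D := [set p | x p != w p].
have [leAD|ltAD] := leqP (2 ^ e.+1) #|A :&: D|.
  (* On [D] the query contradicts [w], which is right at entry [k], so the score is [k]. *)
  exists (inord k); apply: (resistsS (S := pairs k k1 s w (A :&: D) B)).
    apply/fintype.subsetP => s' s'P; rewrite finset.in_setI.
    have sub := pairsS k k1 s w (finset.subsetIl A D) (fintype.subxx B).
    rewrite (fintype.subsetP sub)// inE /=.
    have [P [/finset.setIP[_ kD] _ e0 _]] := pairsP _ _ _ _ _ _ _ s'P.
    rewrite -val_eqE /= inordK; last by rewrite ltnS ltnW.
    rewrite (@score_eqS _ _ _ k) ?agk//; first by rewrite ltnW.
    by rewrite agreeS agk//= e0; move: kD; rewrite inE eq_sym.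
  by apply: IH => //; apply: fintype.subset_trans AB; apply: finset.subsetIl.
(* Off [D] the query copies [w]: right at entry [k], wrong at entry [k1]. *)
exists (inord k1); apply: (resistsS (S := pairs k k1 s w (A :\: D) (B :\: D))).
  apply/fintype.subsetP => s' s'P; rewrite finset.in_setI.
  have sub := pairsS k k1 s w (finset.subsetDl A D) (finset.subsetDl B D).
  rewrite (fintype.subsetP sub)// inE /=.
  have [P [/finset.setDP[_ kD] /finset.setDP[_ k1D] e0 e1]] :=
    pairsP _ _ _ _ _ _ _ s'P.
  rewrite !inE !negbK in kD k1D.
  rewrite -val_eqE /= inordK; last by rewrite ltnS ltnW.
  have agk1 : agree s' x k1 by rewrite k1E agreeS agk//= e0 eq_sym.
  rewrite (@score_eqS _ _ _ k1) ?agk1//; first by rewrite ltnW.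
  by rewrite agreeS agk1 /= (eqP k1D) e1.
apply: IH; first exact: finset.setSD.
  exact: fintype.subset_trans (finset.subsetDl _ _) Br.
rewrite -(leq_add2l #|A :&: D|) cardsID; apply: leq_trans leA.
by rewrite (expnS _ e.+1) mul2n -addnn leq_add2r ltnW.
Qed.

(** Each of the [c] phases uses up two positions and resists [e] queries; the reserve of [2 ^ e.+1]
    positions keeps the initial [A] large enough in every phase. *)
Lemma resists_same_prefix n c k e (s : secret n) : k + c.*2 + 2 ^ e.+1 <= n ->
  resists (c * e) (same_prefix k s).
Proof.
elim: c k s => [|c IH] k s le.
  (* With no phase left, entry [k] is still free; flipping its bit yields a second secret. *)
  have lt : k < n.
    by apply: leq_trans le; rewrite addn0 -addn1 leq_add2l expn_gt0.
  rewrite /=; apply/card_gt1P.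
  exists s, ([ffun p => s.1 p (+) (p == s.2 (Ordinal lt))], s.2); split.
  - exact/same_prefixP.
  - apply/same_prefixP => j jk; split=> //=; rewrite ffunE (inj_eq perm_inj).
    by rewrite -val_eqE /= ltn_eqF// addbF.
  - apply/eqP => /(congr1 (fun t : secret n => t.1 (s.2 (Ordinal lt)))) /=.
    by rewrite ffunE eqxx; case: (s.1 _).
have le2 : k.+2 + c.*2 + 2 ^ e.+1 <= n by move: le; rewrite doubleS !addnS !addSn.
have lt1 : k.+1 < n.
  by apply: leq_trans le2; rewrite -addnA leq_addr.
pose K : 'I_n := Ordinal (ltnW lt1).
have := @resists_pairs n K (Ordinal lt1) (c * e) s [ffun=> false] e
  (rest k s) (rest k s) erefl (fun s' => IH _ s' le2).
rewrite !fintype.subxx card_rest mulSn => res.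
apply: (resistsS _ (res _ _ _)) => //.
  by apply/fintype.subsetP => s' /pairsP[].
rewrite leq_subRL; last exact: ltnW (ltnW lt1).
by apply: leq_trans le; rewrite leq_add2r leq_addr.
Qed.

Lemma query_complexity_gt n c e : c.*2 + 2 ^ e.+1 <= n ->
  c * e < query_complexity n.
Proof.
move=> le; apply: resists_query_complexity.
rewrite -(same_prefix0 ([ffun=> false], 1%g)).
exact: resists_same_prefix.
Qed.

(** * Asymptotics in terms of the natural logarithm *)

Import numFieldNormedType.Exports.
Import Order.TTheory GRing.Theory Num.Theory.
Local Open Scope classical_set_scope.
Local Open Scope ring_scope.

(** Both bounds are [ln (1 + x) <= x], at [x = - 1 / 2] and at [x = 1]. *)
Lemma ln2_bounds (R : realType) : 1 / 2 <= ln (2 : R) <= 1.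
Proof.
apply/andP; split.
  have := @le_ln1Dx R (- (1 / 2)).
  have -> : 1 - 1 / 2 = 2^-1 :> R by lra.
  rewrite lnV ?posrE// lerNl opprK; apply; lra.
have -> : 2 = 1 + 1 :> R by lra.
by apply: le_ln1Dx; lra.
Qed.

Lemma trunc_log_ln (R : realType) n : (0 < n)%N ->
  (trunc_log 2 n)%:R / 2 <= ln (n%:R : R) <= (trunc_log 2 n).+1%:R.
Proof.
move=> n0; have /andP[l1 l2] := ln2_bounds R.
have p2 : (0 : R) < 2 by [].
have np : (0 : R) < n%:R by rewrite ltr0n.
apply/andP; split.
  apply: (@le_trans _ _ (ln (2 ^+ trunc_log 2 n))).
    rewrite lnXn// -[ln _ *+ _]mulr_natl ler_wpM2l//; lra.
  by rewrite ler_ln ?posrE ?exprn_gt0// -natrX ler_nat trunc_logP.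
apply: (@le_trans _ _ (ln (2 ^+ (trunc_log 2 n).+1))).
  by rewrite ler_ln ?posrE ?exprn_gt0// -natrX ler_nat ltnW// trunc_log_ltn.
by rewrite lnXn// -[ln _ *+ _]mulr_natl ler_piMr.
Qed.

Theorem theorem3p1 (R : realType) :
  (fun n : nat => (query_complexity n)%:R : R^o)
    =Theta_\oo (fun n : nat => n%:R * ln (n%:R : R) : R^o).
Proof.
(* With [t] the truncated binary logarithm, 1/32 is the product of the losses in [n / 8 <= n %/ 4]
   and [(t + 1) / 4 <= t - 2], and 4 works because [t + 2 <= 2 * t <= 4 * ln n]. *)
rewrite eqThetaE; apply/asboolP; exists (1 / 32, 4).
  by rewrite /= divr_gt0 ?ltr0n.
near=> n.
have n8 : (8 <= n)%N by near: n; exists 8%N.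
have n0 : (0 < n)%N by exact: leq_trans n8.
have /andP[l1 l2] := trunc_log_ln R n0.
set t := trunc_log 2 n in l1 l2.
have t3 : (3 <= t)%N by rewrite trunc_log_max.
have t3R : 3 <= t%:R :> R by rewrite ler_nat.
have n8R : 8 <= n%:R :> R by rewrite ler_nat.
have ln0 : 0 <= ln (n%:R : R) by rewrite (le_trans _ l1)// divr_ge0.
rewrite /= ger0_norm ?mulr_ge0// ger0_norm//; split.
  (* The [n %/ 4] pairs occupy at most half of the positions, and the reserve [2 ^ (t - 1)] fits in
     the other half. *)
  have : (n %/ 4 * (t - 2) < query_complexity n)%N.
    apply: query_complexity_gt.
    have := trunc_logP (isT : 1 < 2)%N n0.
    rewrite -/t -{1}(subnK (ltnW t3)) addn2 !expnS.
    by move: (2 ^ (t - 2))%N => u; lia.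
  move=> /ltnW; rewrite -(ler_nat R); apply: le_trans.
  have c : n%:R / 8 <= (n %/ 4)%:R :> R.
    rewrite ler_pdivrMr// -natrM ler_nat; lia.
  have d : (t.+1)%:R / 4 <= (t - 2)%:R :> R.
    rewrite natrB ?(ltnW t3)// -natr1; lra.
  rewrite natrM; apply: le_trans (ler_pM _ _ c d); [|lra|lra].
  have : n%:R * ln n%:R <= n%:R * (t.+1)%:R :> R by rewrite ler_wpM2l.
  lra.
have : (query_complexity n <= n * t.+2)%N.
  apply: leq_trans (query_complexity_leq n) _; rewrite leq_mul2l ltnS.
  apply/orP; right.
  apply: up_log_min => //; exact: ltnW (trunc_log_ltn _ _).
rewrite -(ler_nat R) => /le_trans; apply; rewrite natrM mulrCA.
rewrite ler_wpM2l// -addn2 natrD; lra.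
Unshelve. all: end_near.
Qed.
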